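(* Let $X$ be a $q$-homogeneous tree with $q\ge 2$ and origin $o$, and let $\alpha>1$. Then $$\sup_{v\in X\setminus\{o\}}\ \sup_{x,y\in T_v}\ \sum_{z\in X\setminus T_v}|K_\alpha(z,x)-K_\alpha(z,y)|\,q^{-\alpha|z|}<+\infty.$$
   Context: A $q$-homogeneous tree $X$ ($q\ge 2$ an integer) is an undirected connected cycle-free graph in which every vertex has exactly $q+1$ neighbours; $X$ also denotes its vertex set, $o\in X$ is a fixed origin and $|x|$ is the graph distance of $x$ from $o$. $[o,x]$ is the unique path from $o$ to $x$. The sector of $v\neq o$ is $T_v=\{x\in X:[o,v]\subseteq[o,x]\}$. A function $f:X\to\mathbb{C}$ is harmonic if $f(v)=\frac1{q+1}\sum_{u\sim v}f(u)$ for every $v\in X$, where $u\sim v$ means adjacency. For $\alpha>1$, $\mathcal{A}^2_\alpha$ is the Hilbert space of harmonic functions $f$ on $X$ with $\sum_{x\in X}|f(x)|^2q^{-\alpha|x|}<\infty$ (scalar product $\sum_xf(x)\overline{g(x)}q^{-\alpha|x|}$). It is a reproducing kernel Hilbert space and $K_\alpha:X\times X\to\mathbb{R}$ denotes its reproducing kernel: $K_\alpha(z,\cdot)\in\mathcal{A}^2_\alpha$ and $\sum_xg(x)K_\alpha(z,x)q^{-\alpha|x|}=g(z)$ for all $g\in\mathcal{A}^2_\alpha$, $z\in X$. *)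

(* Defs.v *)
From mathcomp Require Import all_boot all_order all_algebra finmap.
From mathcomp Require Import complex.
From mathcomp Require Import all_classical all_reals all_analysis.
From mathcomp.analysis.showcase Require Import summability.

Set Implicit Arguments.
Unset Strict Implicit.
Unset Printing Implicit Defensive.

Import Order.TTheory GRing.Theory Num.Theory.
Import numFieldNormedType.Exports.

Local Open Scope classical_set_scope.
Local Open Scope ring_scope.
Local Open Scope complex_scope.

Section Tree.
Context {X : choiceType} (adj : rel X).

Definition neighbours (v : X) : set X := [set u | adj v u].

(* In a cycle-free graph, closed walks of size 2 without repetition
   (an edge traversed back and forth) are still [ucycle]s. *)
Record homogeneous_tree (q : nat) : Prop := HomogeneousTree {
  adj_sym : symmetric adj;
  adj_irr : irreflexive adj;
  adj_connected : forall x y, exists2 p, path adj x p & last x p = y;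
  adj_acyclic : forall c : seq X, ucycle adj c -> (size c <= 2)%N;
  adj_degree : forall v, (neighbours v #= `I_q.+1)%card
}.

Definition walk_of_length (x y : X) (n : nat) : Prop :=
  exists p, [/\ path adj x p, last x p = y & size p = n].

(* The value 0 is only a default for vertices in different components. *)
Definition graph_dist (x y : X) : nat :=
  xget 0%N [set n | walk_of_length x y n /\
                    forall m, walk_of_length x y m -> (n <= m)%N].

(* Vertex set of [x, y]: in a tree the path without repetition from x to y is
   unique, so the existential below ranges over a single p. *)
Definition geodesic (x y : X) : set X :=
  [set w | exists p, [/\ path adj x p, uniq (x :: p), last x p = y
                       & w \in x :: p]].

Definition sector (o v : X) : set X :=
  [set x | geodesic o v `<=` geodesic o x].

End Tree.

Section Bergman.
Context {R : realType} {X : choiceType} (adj : rel X) (o : X).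
Variables (q : nat) (alpha : R).

Definition harmonic (f : X -> R[i]) : Prop :=
  forall v, f v = (q.+1%:R)^-1 * \sum_(u \in neighbours adj v) f u.

Definition weight (x : X) : R :=
  q%:R `^ (- (alpha * (graph_dist adj o x)%:R)).

(* The modulus [`|f x|] lives in [R[i]]; [complex.Re] brings it back to [R]. *)
Definition bergman_space : set (X -> R[i]) :=
  [set f | harmonic f /\
    (\esum_(x in [set: X]) (complex.Re `|f x| ^+ 2 * weight x)%:E < +oo)%E].

(* Complex sums over X are unconditional: limits along the finite subsets
   of X.  As K is real-valued, it needs no conjugation. *)
Definition reproducing_kernel (K : X -> X -> R) : Prop :=
  forall z,
    bergman_space (fun x => (K z x)%:C) /\
    forall g, bergman_space g ->
      partial_sum (fun x => g x * (K z x)%:C * (weight x)%:C) @ totally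
        --> (g z : R[i]^o).

End Bergman.

(* Main.v *)
Require Import Defs.
From mathcomp Require Import all_boot all_order all_algebra finmap complex.
From mathcomp Require Import all_classical all_reals all_analysis.
From mathcomp.analysis.showcase Require Import summability.
From mathcomp Require Import ring lra.

Set Implicit Arguments.
Unset Strict Implicit.
Unset Printing Implicit Defensive.

Import Order.TTheory GRing.Theory Num.Theory.

Local Open Scope classical_set_scope.
Local Open Scope ring_scope.

(** The kernel never has to be computed: its differences along edges are
    controlled by testing the reproducing property on a few explicit functions.

    Root the tree at o. For a vertex a with parent p, let [sector_radial a] be
    the function that vanishes off the sector of a and equals
    1 + 1/q + ... + 1/q^k at distance k below a. Its mean value
    property fails only at p, and the defect there does not depend on a
    ([sum_nbr_sector_radial]). So for two children a, b of p the dipole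
    h = [sector_radial a] - [sector_radial b] is harmonic; it is bounded by 2
    and lives on two sectors of finite weighted mass, so it is square summable.

    A harmonic function g has sums over the levels of a sector that depend only
    on its values at the two ends of the edge above it ([sum_level]). Hence the
    weighted sum of h g over a large ball is g(a) - g(b) times a positive number
    at least q^(-alpha |a|). Taking g = K z, the reproducing property identifies
    the limit of these sums with h(z), so
      |K z a - K z b| q^(-alpha |a|) <= |h(z)|       ([kernel_siblings]).
    Consequently sibling differences vanish for z outside both sectors, and
    their weighted sums over z are bounded independently of a and b, the mass
    of a sector being of order q^(-alpha |a|) ([sum_siblings]).

    Harmonicity of K z expresses q times the difference of K z along an edge as
    its difference along the previous edge plus q sibling differences
    ([kernel_edge]). After division by q this is a contraction, so the weighted
    sums over z of edge differences are uniformly bounded ([sum_edge]). When z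
    lies outside the sector of v, the sibling terms below v vanish and the edge
    differences decay geometrically below v; the oscillation of K z on the whole
    sector is therefore at most twice its difference along the edge above v
    ([kernel_outside_sector]), and the bound follows. *)

(** * Simple paths in a graph without cycles *)

Section SimplePath.
Context {X : choiceType} (adj : rel X).
Hypothesis adjC : symmetric adj.
Hypothesis acyclic : forall c : seq X, ucycle adj c -> (size c <= 2)%N.

(** If two simple paths with the same ends leave x through different neighbours,
    following the first until it meets the second and returning along the
    second closes a cycle of size at least 3. *)
Lemma simple_path_inj x (p p' : seq X) :
  path adj x p -> path adj x p' -> uniq (x :: p) -> uniq (x :: p') ->
  last x p = last x p' -> p = p'.
Proof.
elim: p x p' => [|y p IH] x [|y' p'] //=.
- move=> _ _ _ /andP[xp' _] e; move: xp'.
  by rewrite e mem_last.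
- move=> _ _ /andP[xp _] _ e; move: xp.
  by rewrite -e mem_last.
move=> /andP[xy pp] /andP[xy' pp'] /andP[xnp up] /andP[xnp' up'] e.
have [yy'|yy'] := eqVneq y y'.
  by move: pp' up' e; rewrite -yy' => pp' up' e; rewrite (IH y p').
exfalso.
have hw : has (mem (y' :: p')) (y :: p).
  by apply/hasP; exists (last y p); rewrite ?mem_last //= e mem_last.
(* w is the first vertex of p on the other path, so l1 avoids that path. *)
have [l1 [w [l2 [el1 wp' hl1]]]] : exists l1 w l2,
    [/\ y :: p = rcons l1 w ++ l2, w \in y' :: p' & ~~ has (mem (y' :: p')) l1].
  by case/split_find: hw => w l1 l2 hw hl1; exists l1, w, l2.
have [m1 [m2 em]] : exists m1 m2, y' :: p' = m1 ++ w :: m2.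
  by case/splitPr: wp' => m1 m2; exists m1, m2.
have ux : uniq (x :: l1 ++ [:: w] ++ m1).
  have u1 : uniq (x :: rcons l1 w).
    have : uniq (x :: y :: p) by rewrite /= xnp.
    by rewrite el1 -cat_cons cat_uniq => /andP[].
  have u2 : uniq (x :: m1 ++ w :: m2) by rewrite -em /= xnp'.
  rewrite catA cats1 -cat_cons cat_uniq u1 /=; apply/andP; split.
    apply/hasPn => z zm; rewrite inE mem_rcons inE !negb_or.
    apply/and3P; split.
    - by apply: contraL u2 => /eqP <- /=; rewrite mem_cat zm.
    - apply: contraL u2 => /eqP <- /=.
      by rewrite cat_uniq /= zm andbF /= andbF.
    - apply: contraNN hl1 => zl; apply/hasP; exists z => //=.
      by rewrite em mem_cat zm.
  by move: u2; rewrite /= cat_uniq => /and3P[].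
have px : path adj x (rcons l1 w).
  have : path adj x (y :: p) by rewrite /= xy.
  by rewrite el1 cat_path => /andP[].
have px' : path adj x (rcons m1 w).
  have : path adj x (y' :: p') by rewrite /= xy'.
  by rewrite em -cat_rcons cat_path => /andP[].
have cyc : cycle adj (x :: rcons l1 w ++ rev m1).
  rewrite /= rcons_cat cat_path px last_rcons /=.
  have := rev_path adj x (rcons m1 w).
  rewrite last_rcons belast_rcons rev_cons => ->.
  by rewrite (eq_path (e' := adj)) // => a b; rewrite adjC.
have ucyc : uniq (x :: rcons l1 w ++ rev m1).
  rewrite -(perm_uniq (s1 := x :: l1 ++ [:: w] ++ m1)) //.
  by rewrite catA cats1 perm_cons perm_cat2l perm_sym perm_rev.
have := acyclic (c := x :: rcons l1 w ++ rev m1).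
rewrite /ucycle cyc ucyc => /(_ isT) /=.
rewrite size_cat size_rcons size_rev addSn !ltnS leqn0 addn_eq0.
move=> /andP[/nilP l10 /nilP m10]; subst l1 m1.
by case: em el1 yy' => -> _ [-> _]; rewrite eqxx.
Qed.

End SimplePath.

(** * The tree rooted at the origin *)

Section RootedTree.
Context {X : choiceType} (adj : rel X) (o : X) (q : nat).
Hypothesis tree : homogeneous_tree adj q.

Definition rpath (x : X) : seq X :=
  xget [::] [set p | [/\ path adj o p, uniq (o :: p) & last o p = x]].

Lemma rpathP x : [/\ path adj o (rpath x), uniq (o :: rpath x)
                   & last o (rpath x) = x].
Proof.
rewrite /rpath; case: xgetP => [//|H]; exfalso.
have [p px lx] := adj_connected tree o x.
move: lx; case/shortenP: px => p' pp' up' _ lx.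
exact: (H p').
Qed.

Lemma rpath_last p : path adj o p -> uniq (o :: p) -> rpath (last o p) = p.
Proof.
move=> pp up; have [pr ur lr] := rpathP (last o p).
exact: (simple_path_inj (adj_sym tree) (adj_acyclic tree) pr pp ur up lr).
Qed.

Lemma last_rpath x : last o (rpath x) = x. Proof. by have [] := rpathP x. Qed.

Lemma rpath_root : rpath o = [::]. Proof. exact: (@rpath_last [::]). Qed.

Definition depth x := size (rpath x).

Lemma depth_min p : path adj o p -> (depth (last o p) <= size p)%N.
Proof.
case/shortenP => p' pp' up' sub_p'; rewrite /depth rpath_last //.
by apply: uniq_leq_size => //; have /andP[] := up'.
Qed.

Lemma graph_dist_depth x : graph_dist adj o x = depth x.
Proof.
have [pr ur lr] := rpathP x.
have wx : walk_of_length adj o x (depth x) by exists (rpath x).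
have x_min m : walk_of_length adj o x m -> (depth x <= m)%N.
  by move=> [p [pp <- <-]]; exact: depth_min.
rewrite /graph_dist; case: xgetP => [n _ [wn n_min]|/(_ (depth x)) []//].
by apply/eqP; rewrite eqn_leq n_min //= x_min.
Qed.

Definition child u c := rpath c == rcons (rpath u) c.

(** Either y is off the path from o to x, and appending it gives the path to y,
    or y cuts that path, whose initial piece followed by x must be all of it. *)
Lemma adj_child x y : adj x y = child x y || child y x.
Proof.
have [px ux lx] := rpathP x; have [py uy ly] := rpathP y.
apply/idP/orP => [xy|[] /eqP e]; last 2 first.
- by move: py; rewrite e rcons_path lx => /andP[].
- by move: px; rewrite e rcons_path ly (adj_sym tree) => /andP[].
have [yx|yNx] := boolP (y \in o :: rpath x); last first.
  left; apply/eqP; rewrite -[in LHS](last_rcons o (rpath x) y).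
  apply: rpath_last; first by rewrite rcons_path px lx.
  by rewrite -rcons_cons rcons_uniq yNx.
right; apply/eqP; case/splitPl: yx px ux lx => p1 p2 l1.
rewrite cat_path l1 -cat_cons cat_uniq => /andP[pp1 pp2] /and3P[up1 hp up2] lx.
have <- : p1 = rpath y by rewrite -l1 rpath_last.
apply: (simple_path_inj (adj_sym tree) (adj_acyclic tree) (x := o)).
- by rewrite cat_path pp1 l1.
- by rewrite rcons_path pp1 l1 (adj_sym tree).
- by rewrite -cat_cons cat_uniq up1 hp.
- rewrite -rcons_cons rcons_uniq up1 andbT.
  have xp2 : x \in p2.
    move: lx; rewrite last_cat l1 => lx.
    have := mem_last y p2; rewrite lx inE => /orP[/eqP e|//].
    by move: xy; rewrite e (adj_irr tree).
  by apply: contraNN hp => xp1; apply/hasP; exists x.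
- by rewrite last_rcons.
Qed.

Lemma depth_child u c : child u c -> depth c = (depth u).+1.
Proof. by rewrite /child /depth => /eqP ->; rewrite size_rcons. Qed.

Definition parent x := last o (take (depth x).-1 (rpath x)).

Lemma parent_child u c : child u c -> parent c = u.
Proof.
move=> uc; rewrite /parent (depth_child uc) (eqP uc) /=.
by rewrite -cats1 take_size_cat // last_rpath.
Qed.

Lemma tree_ind (P : X -> Prop) :
  P o -> (forall u c, child u c -> P u -> P c) -> forall x, P x.
Proof.
move=> Po Pc x; rewrite -(last_rpath x); have [px ux _] := rpathP x.
elim/last_ind: (rpath x) px ux => [//|p y IH].
rewrite rcons_path -rcons_cons rcons_uniq => /andP[pp py] /andP[yp up].
rewrite last_rcons; apply: (Pc (last o p)); last exact: IH.
apply/eqP; rewrite (rpath_last pp up) -[in LHS](last_rcons o p y).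
by rewrite rpath_last ?rcons_path ?pp // -rcons_cons rcons_uniq yp.
Qed.

Lemma childP x : x = o \/ exists u, child u x.
Proof. by elim/tree_ind: x => [|u c uc _]; [left|right; exists u]. Qed.

Lemma not_child_root u : child u o = false.
Proof. by apply/negP => /depth_child; rewrite {1}/depth rpath_root. Qed.

(** The sector of v as a boolean predicate, see [sector_below]. *)
Definition below v x := v \in o :: rpath x.

Lemma below_cat v x : below v x -> exists p, rpath x = rpath v ++ p.
Proof.
have [px ux lx] := rpathP x.
move=> vx; case/splitPl: vx px ux lx => p1 p2 l1.
rewrite cat_path -cat_cons cat_uniq => /andP[pp1 _] /and3P[up1 _ _] _.
by exists p2; rewrite -l1 rpath_last.
Qed.

Lemma sector_below v x : sector adj o v x <-> below v x.
Proof.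
have geoE w : geodesic adj o w = [set z | z \in o :: rpath w].
  apply/seteqP; split => z /=.
    by move=> [p [pp up lp]]; rewrite -(rpath_last pp up) lp.
  by have [pw uw lw] := rpathP w => zw; exists (rpath w).
rewrite /sector /= !geoE; split => [|vx z /=].
  by apply; rewrite /= -{1}(last_rpath v) mem_last.
by have [p ->] := below_cat vx; rewrite -cat_cons mem_cat => ->.
Qed.

Lemma below_trans u v x : below u v -> below v x -> below u x.
Proof.
move=> uv /below_cat[p]; rewrite /below => ->.
by rewrite -cat_cons mem_cat [u \in _]uv.
Qed.

Lemma below_refl x : below x x.
Proof. by rewrite /below -{1}(last_rpath x) mem_last. Qed.

Lemma below_root x : below o x. Proof. exact: mem_head. Qed.

Lemma below_child v u c : child u c -> below v c = (v == c) || below v u.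
Proof. by rewrite /below => /eqP ->; rewrite -rcons_cons mem_rcons inE. Qed.

Lemma below_depth v x : below v x -> (depth v <= depth x)%N.
Proof.
by move=> /below_cat[p]; rewrite /depth => ->; rewrite size_cat leq_addr.
Qed.

Lemma below_depth_eq v x : below v x -> depth x = depth v -> x = v.
Proof.
move=> /below_cat[p]; rewrite /depth => e; rewrite e size_cat => /eqP.
rewrite -{2}[size _]addn0 eqn_add2l => /nilP p0.
by rewrite -[LHS]last_rpath e p0 cats0 last_rpath.
Qed.

Lemma below_has_parent p a y : child p a -> below a y -> exists u, child u y.
Proof.
move=> pa ay; have [y0|//] := childP y; exfalso; move: ay pa.
by rewrite y0 /below rpath_root inE => /eqP ->; rewrite not_child_root.
Qed.

(** Neighbours as a sequence, over which the mean value property is an ordinary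
    finite sum. *)
Definition nbr v : seq X := fset_set (neighbours adj v).

Lemma neighbours_finite v : finite_set (neighbours adj v).
Proof. by apply/finite_setP; exists q.+1; exact: (adj_degree tree). Qed.

Lemma nbr_uniq v : uniq (nbr v). Proof. exact: fset_uniq. Qed.

Lemma mem_nbr v u : (u \in nbr v) = adj v u.
Proof.
rewrite /nbr in_fset_set; last exact: neighbours_finite.
by apply/idP/idP; rewrite inE.
Qed.

Lemma size_nbr v : size (nbr v) = q.+1.
Proof. by rewrite /nbr (card_fset_set (adj_degree tree v)). Qed.

Definition kids u := [seq c <- nbr u | child u c].

Lemma mem_kids u c : (c \in kids u) = child u c.
Proof. by rewrite mem_filter mem_nbr adj_child; case: (child u c). Qed.

Lemma kids_uniq u : uniq (kids u). Proof. exact/filter_uniq/nbr_uniq. Qed.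

Lemma kids_root : kids o = nbr o.
Proof.
apply/all_filterP/allP => c; rewrite mem_nbr adj_child.
by rewrite [child c o]not_child_root orbF.
Qed.

Lemma nbr_perm p u : child p u -> perm_eq (nbr u) (p :: kids u).
Proof.
move=> pu; apply: uniq_perm; rewrite ?nbr_uniq //=.
  rewrite kids_uniq andbT mem_kids; apply/negP => up.
  have := depth_child up; rewrite (depth_child pu) => /eqP.
  by rewrite eqn_leq ltnNge leqnSn /= andbF.
move=> x; rewrite mem_nbr inE mem_kids adj_child orbC; congr orb.
apply/idP/eqP => [xu|->//].
by rewrite -(parent_child xu) (parent_child pu).
Qed.

Lemma size_kids p u : child p u -> size (kids u) = q.
Proof. by move=> /nbr_perm/perm_size; rewrite size_nbr /= => -[]. Qed.

Fixpoint level a k : seq X :=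
  if k is k'.+1 then [seq c | y <- level a k', c <- kids y] else [:: a].

Lemma mem_level a k x :
  (x \in level a k) = below a x && (depth x == depth a + k)%N.
Proof.
elim: k x => [|k IH] x.
  rewrite addn0 inE; apply/eqP/andP => [->|[ax /eqP]]; last exact: below_depth_eq.
  by rewrite below_refl.
apply/allpairsPdep/andP => [[y [c [yl]]]|[ax /eqP dx]].
  move: yl; rewrite IH mem_kids => /andP[ay /eqP dy] yc ->.
  by rewrite (below_child _ yc) ay orbT (depth_child yc) dy addnS.
have [x0|[y yx]] := childP x.
  by move: dx; rewrite {1}/depth x0 rpath_root addnS.
exists y, x; rewrite mem_kids IH; split=> //.
move: ax dx; rewrite (below_child _ yx) (depth_child yx) addnS => + [dx].
rewrite dx eqxx andbT => /orP[/eqP ax|//].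
move/eqP: dx; rewrite ax (depth_child yx) addSnnS.
by rewrite -{1}[depth y]addn0 eqn_add2l.
Qed.

Lemma level_uniq a k : uniq (level a k).
Proof.
elim: k => [//|k IH] /=; apply: allpairs_uniq_dep => //.
  by move=> y _; exact: kids_uniq.
move=> _ _ /allpairsPdep[y [c [_ yc ->]]] /allpairsPdep[y' [c' [_ yc' ->]]] /= cc.
move: yc yc'; rewrite !mem_kids -cc => yc yc'.
by rewrite -(parent_child yc) -(parent_child yc').
Qed.

(** The origin is excluded, since it has q + 1 children instead of q. *)
Lemma size_level p a k : child p a -> size (level a k) = (q ^ k)%N.
Proof.
move=> pa; elim: k => [//|k IH] /=.
rewrite size_allpairs_dep sumnE big_map (eq_big_seq (fun=> q)) => [|y].
  by rewrite big_const_seq count_predT iter_addn_0 IH expnS.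
rewrite mem_level => /andP[ay _].
by have [u uy] := below_has_parent pa ay; exact: size_kids uy.
Qed.

(** The part of the sector of a at distance less than n from a; for a = o it is
    a ball around the origin. *)
Definition cone a n : seq X := [seq x | k <- iota 0 n, x <- level a k].

Lemma mem_cone a n x : (x \in cone a n) = below a x && (depth x < depth a + n)%N.
Proof.
apply/allpairsPdep/andP => [[k [y [ki yl ->]]]|[ax dx]].
  move: ki yl; rewrite mem_iota mem_level => /andP[_ kn] /andP[-> /eqP ->].
  by rewrite ltn_add2l.
have e : depth x = (depth a + (depth x - depth a))%N.
  by rewrite subnKC // below_depth.
exists (depth x - depth a)%N, x; rewrite mem_iota mem_level ax -e eqxx.
by split=> //; rewrite leq0n /= -(ltn_add2l (depth a)) -e.
Qed.

Lemma cone_uniq a n : uniq (cone a n).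
Proof.
apply: allpairs_uniq_dep => [|k _|]; [exact: iota_uniq|exact: level_uniq|].
move=> _ _ /allpairsPdep[y [c [_ yc ->]]] /allpairsPdep[y' [c' [_ yc' ->]]] /= cc.
move: yc yc'; rewrite !mem_level -cc => /andP[_ /eqP ->] /andP[_].
by rewrite eqn_add2l => /eqP ->.
Qed.

(** A ball around o cuts every sector in one of its truncations, which reduces
    sums over balls to sums over levels. *)
Lemma cone_root a n :
  perm_eq [seq x <- cone o n | below a x] (cone a (n - depth a)).
Proof.
apply: uniq_perm; rewrite ?filter_uniq ?cone_uniq // => x.
rewrite mem_filter !mem_cone below_root {2}/depth rpath_root add0n /=.
have [/below_depth ax|//] := boolP (below a x).
have [an|/ltnW an] := leqP (depth a) n; first by rewrite subnKC.
rewrite (eqP (_ : n - depth a == 0)%N) ?subn_eq0 // addn0 /=.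
by rewrite !ltnNge ax (leq_trans an ax).
Qed.

End RootedTree.

(** * Harmonic functions on sectors *)

Lemma ler_sum_subset (R : numDomainType) (T : eqType) (s t : seq T) (f : T -> R) :
  uniq s -> uniq t -> {subset s <= t} -> (forall x, 0 <= f x) ->
  \sum_(x <- s) f x <= \sum_(x <- t) f x.
Proof.
move=> us ut st f0.
have st_perm : perm_eq t (s ++ [seq x <- t | x \notin s]).
  apply: uniq_perm => //.
    rewrite cat_uniq us filter_uniq // andbT.
    by apply/hasPn => x; rewrite mem_filter => /andP[].
  move=> x; rewrite mem_cat mem_filter.
  by have [/st ->|] := boolP (x \in s).
by rewrite (perm_big _ st_perm) big_cat /= lerDl sumr_ge0.
Qed.

Section Harmonic.
Context {R : realType} {X : choiceType} (adj : rel X) (o : X) (q : nat).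
Hypothesis tree : homogeneous_tree adj q.
Hypothesis q_ge2 : (2 <= q)%N.

Local Notation child := (child adj o).
Local Notation below := (below adj o).
Local Notation depth := (depth adj o).
Local Notation kids := (kids adj o).
Local Notation nbr := (nbr adj).
Local Notation level := (level adj o).
Local Notation cone := (cone adj o).

(** The common shape of radial harmonic functions that vanish at the parent of
    the root of their sector. *)
Definition geo k : R := \sum_(j < k) q%:R ^- j.

Lemma qR_gt0 : 0 < q%:R :> R. Proof. by rewrite ltr0n (leq_trans _ q_ge2). Qed.

Lemma geo0 : geo 0 = 0. Proof. exact: big_ord0. Qed.

Lemma geoS k : geo k.+1 = geo k + q%:R ^- k. Proof. exact: big_ord_recr. Qed.

Lemma geo1 : geo 1 = 1. Proof. by rewrite geoS geo0 add0r expr0 invr1. Qed.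

Lemma geo_ge0 k : 0 <= geo k.
Proof.
by apply: sumr_ge0 => j _; rewrite invr_ge0 exprn_ge0 // ltW // qR_gt0.
Qed.

Lemma geo_le2 k : geo k <= 2.
Proof.
(* The remainder term makes the bound inductive: halving it pays for the next
   summand because 1/q <= 1/2. *)
suff : geo k + q%:R ^- k *+ 2 <= 2.
  by apply: le_trans; rewrite lerDl mulrn_wge0 // invr_ge0 exprn_ge0.
elim: k => [|k]; first by rewrite geo0 expr0 invr1 add0r.
apply: le_trans; rewrite geoS -addrA lerD2l exprS invfM mulr2n.
have q2 : q%:R^-1 <= 2^-1 :> R by rewrite lef_pV2 ?posrE ?qR_gt0 // ler_nat.
have k0 : 0 <= q%:R ^- k :> R by rewrite invr_ge0 exprn_ge0 // ltW // qR_gt0.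
by nra.
Qed.

(** The mean value property for a radial function, q children being one step
    further and the parent one step closer. *)
Lemma geo_rec k : q%:R * geo k.+2 = (q.+1)%:R * geo k.+1 - geo k.
Proof.
have q0 := qR_gt0; have qk0 : 0 < q%:R ^+ k :> R by rewrite exprn_gt0.
rewrite !geoS exprS -natr1; field.
by rewrite (gt_eqF q0) (gt_eqF qk0).
Qed.

(** Harmonicity for real functions, free of division and of complex numbers. *)
Definition mean_valued (g : X -> R) :=
  forall v, \sum_(u <- nbr v) g u = q.+1%:R * g v.

Lemma sum_kids g p u : mean_valued g -> child p u ->
  \sum_(c <- kids u) g c = q.+1%:R * g u - g p.
Proof.
move=> hg pu; rewrite -hg (perm_big _ (nbr_perm tree pu)) big_cons /=.
by rewrite [RHS]addrC addKr.
Qed.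

(** Divided by q^k, the level sums obey the same two-term recursion as [geo],
    because the mean value property gives the sum over the children of y in
    terms of y and its parent. So they are known once g is known at p and a. *)
Lemma sum_level g p a k : mean_valued g -> child p a ->
  \sum_(x <- level a k) g x = q%:R ^+ k * (g p + (g a - g p) * geo k.+1).
Proof.
move=> hg pa.
have below_nroot := below_has_parent tree pa.
(* The sum of the parents' values is the other quantity of the recursion. *)
suff : \sum_(x <- level a k) g x = q%:R ^+ k * (g p + (g a - g p) * geo k.+1) /\
       \sum_(x <- level a k) g (parent adj o x) =
         q%:R ^+ k * (g p + (g a - g p) * geo k) by case.
elim: k => [|k [IH1 IH2]].
  by rewrite /= !big_seq1 (parent_child tree pa) geo1 geo0 expr0; split; ring.
split => /=.
  rewrite big_allpairs_dep /=.
  rewrite (eq_big_seq (fun y => q.+1%:R * g y - g (parent adj o y))).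
    rewrite big_split /= -mulr_sumr IH1 sumrN IH2 exprS.
    have := geo_rec k; rewrite -natr1 => e.
    transitivity
      (q%:R ^+ k * (q%:R * g p + (g a - g p) * (q%:R * geo k.+2))); last by ring.
    by rewrite e; ring.
  move=> y; rewrite (mem_level _ tree) => /andP[/below_nroot[u uy] _].
  by rewrite (sum_kids hg uy) (parent_child tree uy).
rewrite big_allpairs_dep /= (eq_big_seq (fun y => q%:R * g y)).
  by rewrite -mulr_sumr IH1 exprS mulrA.
move=> y; rewrite (mem_level _ tree) => /andP[/below_nroot[u uy] _].
rewrite (eq_big_seq (fun=> g y)).
  by rewrite big_const_seq count_predT (size_kids tree uy) iter_addr_0 mulr_natl.
by move=> c; rewrite (mem_kids _ tree) => /(parent_child tree) ->.
Qed.

(** The shift by one makes the value at a equal to [geo 1] = 1, as if the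
    function started from the value [geo 0] = 0 at the parent of a. *)
Definition sector_radial a x : R :=
  if below a x then geo ((depth x).+1 - depth a) else 0.

Lemma sector_radial_outside a x : ~~ below a x -> sector_radial a x = 0.
Proof. by rewrite /sector_radial => /negbTE ->. Qed.

Lemma sector_radial_ge0 a x : 0 <= sector_radial a x.
Proof. by rewrite /sector_radial; case: ifP => // _; exact: geo_ge0. Qed.

Lemma sector_radial_le a x : sector_radial a x <= 2 * (below a x)%:R.
Proof.
by rewrite /sector_radial; case: ifP => _; rewrite ?mulr1 ?mulr0 ?geo_le2.
Qed.

Lemma child_not_below p a : child p a -> ~~ below a p.
Proof.
move=> pa; apply/negP => /(below_depth tree).
by rewrite (depth_child pa) ltnn.
Qed.

(** Inside the sector this is [geo_rec]; outside, the only vertex with a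
    neighbour in the sector is p. The defect 1 at p is the same for all children
    of p, so it cancels in a difference of two such functions. *)
Lemma sum_nbr_sector_radial p a v : child p a ->
  \sum_(u <- nbr v) sector_radial a u = q.+1%:R * sector_radial a v + (v == p)%:R.
Proof.
move=> pa; have pNa := child_not_below pa.
have [av|aNv] := boolP (below a v).
  have [w wv] := below_has_parent tree pa av.
  have -> : (v == p) = false.
    by apply/negP => /eqP vp; move: pNa; rewrite -vp av.
  rewrite addr0 (perm_big _ (nbr_perm tree wv)) big_cons /=.
  have dav := below_depth tree av.
  have radial_w : sector_radial a w = geo (depth v - depth a).
    move: av; rewrite /sector_radial (below_child _ wv) => /orP[/eqP av|aw].
      by rewrite av subnn -{1}av -(parent_child tree wv) -av (parent_child tree pa)
        (negbTE pNa) geo0.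
    by rewrite aw (depth_child wv).
  rewrite (eq_big_seq (fun=> geo (depth v - depth a).+2)).
    rewrite big_const_seq count_predT (size_kids tree wv) iter_addr_0 radial_w.
    rewrite /sector_radial av subSn // -[geo _ *+ q]mulr_natl geo_rec.
    by rewrite addrC subrK.
  move=> c; rewrite (mem_kids _ tree) => vc.
  rewrite /sector_radial (below_child _ vc) av orbT (depth_child vc).
  by rewrite !subSn // ltnW // ltnS.
rewrite (sector_radial_outside aNv).
rewrite mulr0 add0r.
have -> : \sum_(u <- nbr v) sector_radial a u =
    \sum_(c <- kids v) sector_radial a c.
  have [v0|[w wv]] := childP o tree v; first by rewrite v0 (kids_root _ tree).
  rewrite (perm_big _ (nbr_perm tree wv)) big_cons /=.
  rewrite sector_radial_outside ?add0r //.
  by apply: contraNN aNv => aw; rewrite (below_child _ wv) aw orbT.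
rewrite (eq_big_seq (fun c => (c == a)%:R)); last first.
  move=> c; rewrite (mem_kids _ tree) => vc.
  rewrite /sector_radial (below_child _ vc) (negbTE aNv) orbF eq_sym.
  by case: eqP => // ->; rewrite subSnn geo1.
have -> : (v == p) = child v a.
  apply/eqP/idP => [->//|va].
  by rewrite -(parent_child tree va) (parent_child tree pa).
rewrite -(mem_kids _ tree).
have [av|aNkv] := boolP (a \in kids v).
  rewrite (bigD1_seq a) ?kids_uniq //= eqxx big1 ?addr0 // => c /negbTE ->; by [].
rewrite big_seq big1 // => c cv; case: eqP => // ca.
by move: aNkv; rewrite -ca cv.
Qed.

Lemma sum_cone (F : X -> R) a n :
  \sum_(x <- cone o n) (below a x)%:R * F x =
  \sum_(k < n - depth a) \sum_(x <- level a k) F x.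
Proof.
rewrite (eq_bigr (fun x => if below a x then F x else 0)); last first.
  by move=> x _; case: ifP => _; rewrite ?mul1r ?mul0r.
rewrite -big_mkcond -big_filter (perm_big _ (cone_root _ tree a n)) /=.
by rewrite big_allpairs_dep /= -{1}[(n - depth a)%N]subn0 big_mkord.
Qed.

Section Weight.
Variable r : R.
Hypotheses (r_gt0 : 0 < r) (qr_lt1 : q%:R * r < 1).

Lemma sum_cone_sector_radial g p a n : mean_valued g -> child p a ->
  \sum_(x <- cone o n) sector_radial a x * g x * r ^+ depth x =
  \sum_(k < n - depth a) geo k.+1 * r ^+ (depth a + k) *
      (q%:R ^+ k * (g p + (g a - g p) * geo k.+1)).
Proof.
move=> hg pa.
transitivity (\sum_(x <- cone o n) (below a x)%:R *
    (geo ((depth x).+1 - depth a) * g x * r ^+ depth x)).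
  apply: eq_bigr => x _.
  by rewrite /sector_radial; case: ifP => _; rewrite ?mul0r ?mul1r.
rewrite sum_cone; apply: eq_bigr => k _.
rewrite -(sum_level k hg pa) mulr_sumr.
apply: eq_big_seq => x; rewrite (mem_level _ tree) => /andP[_ /eqP ->].
by rewrite -addnS addKn; ring.
Qed.

(** The contribution g(p) of the parent cancels between the two sectors, which
    leaves a multiple of g(a) - g(b). *)
Lemma sum_cone_pairing g p a b n : mean_valued g -> child p a -> child p b ->
  \sum_(x <- cone o n)
     (sector_radial a x - sector_radial b x) * g x * r ^+ depth x =
  (g a - g b) * \sum_(k < n - depth a)
     (geo k.+1 ^+ 2 * r ^+ (depth a + k) * q%:R ^+ k).
Proof.
move=> hg pa pb.
rewrite (eq_bigr (fun x => sector_radial a x * g x * r ^+ depth x -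
                           sector_radial b x * g x * r ^+ depth x)); last first.
  by move=> x _; ring.
rewrite big_split /= sumrN (sum_cone_sector_radial n hg pa).
rewrite (sum_cone_sector_radial n hg pb).
rewrite (depth_child pb) -(depth_child pa) -sumrN -big_split /= mulr_sumr.
by apply: eq_bigr => k _; ring.
Qed.

(** All the terms of the sum in [sum_cone_pairing] are nonnegative, and the one
    for k = 0 is r ^+ depth a. *)
Lemma pairing_ge g p a b n : mean_valued g -> child p a -> child p b ->
  (depth a < n)%N ->
  `|g a - g b| * r ^+ depth a <=
  `|\sum_(x <- cone o n)
      (sector_radial a x - sector_radial b x) * g x * r ^+ depth x|.
Proof.
move=> hg pa pb an; rewrite (sum_cone_pairing n hg pa pb) normrM.
apply: ler_wpM2l => //; rewrite ger0_norm; last first.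
  by apply: sumr_ge0 => k _; rewrite !mulr_ge0 ?exprn_ge0 ?geo_ge0 ?(ltW r_gt0).
have : (0 < n - depth a)%N by rewrite subn_gt0.
case: (n - depth a)%N => // m _; rewrite big_ord_recl /= geo1 addn0 expr0 !mulr1.
rewrite expr1n mul1r lerDl.
by apply: sumr_ge0 => k _; rewrite !mulr_ge0 ?exprn_ge0 ?geo_ge0 ?(ltW r_gt0).
Qed.

(** The sum of the geometric series of ratio q r: the weighted mass of a sector
    divided by the weight of its root. *)
Definition cone_mass : R := (1 - q%:R * r)^-1.

Lemma cone_mass_gt0 : 0 < cone_mass. Proof. by rewrite invr_gt0 subr_gt0. Qed.

Lemma sum_geometric_le n : \sum_(k < n) (q%:R * r) ^+ k <= cone_mass.
Proof.
have qr0 : 0 <= q%:R * r by rewrite mulr_ge0 // ltW.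
rewrite /cone_mass -[leRHS]mul1r ler_pdivlMr ?subr_gt0 //.
by rewrite mulrC -opprB mulNr -subrX1 opprB gerBl exprn_ge0.
Qed.

Lemma sum_weight_below (s : seq X) p a : uniq s -> child p a ->
  \sum_(x <- s) (below a x)%:R * r ^+ depth x <= cone_mass * r ^+ depth a.
Proof.
move=> us pa; pose n := (\max_(x <- s) depth x)%N.+1.
have f0 x : 0 <= (below a x)%:R * r ^+ depth x.
  by rewrite mulr_ge0 // exprn_ge0 // ltW.
apply: (@le_trans _ _ (\sum_(x <- cone o n) (below a x)%:R * r ^+ depth x)).
  apply: ler_sum_subset => //; first exact: (cone_uniq _ tree).
  move=> x xs; rewrite (mem_cone _ tree) below_root addnS ltnS /=.
  by apply: leq_trans (leq_addl _ _); exact: leq_bigmax_seq.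
rewrite sum_cone (eq_bigr (fun k : 'I__ => (q%:R * r) ^+ k * r ^+ depth a)).
  by rewrite -mulr_suml ler_wpM2r ?sum_geometric_le // exprn_ge0 // ltW.
move=> k _; rewrite (eq_big_seq (fun=> r ^+ (depth a + k))).
  rewrite big_const_seq count_predT (size_level tree _ pa) iter_addr_0.
  by rewrite -[_ *+ (_ ^ _)%N]mulr_natl exprMn exprD natrX; ring.
by move=> x; rewrite (mem_level _ tree) => /andP[_ /eqP ->].
Qed.

End Weight.
End Harmonic.

(** * The reproducing kernel *)

Lemma normcR (R : rcfType) (x : R) : `|x%:C%C| = (`|x|)%:C%C.
Proof. by rewrite normc_def /= expr0n addr0 sqrtr_sqr. Qed.

Lemma esum_le_finite (R : realType) (X : choiceType) (A : set X) (f : X -> R) M :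
  (forall s : seq X, uniq s -> (forall x, x \in s -> A x) ->
     \sum_(x <- s) f x <= M) ->
  (\esum_(x in A) (f x)%:E <= M%:E)%E.
Proof.
move=> fM; apply: ge_ereal_sup => _ [F [finF FA] <-].
rewrite fsbig_finite // sumEFin lee_fin; apply: fM; first exact: fset_uniq.
by move=> x; rewrite in_fset_set // inE => /FA.
Qed.

Lemma cvg_totally (F : numFieldType) (X : choiceType) (f : {fset X} -> F)
    (l e : F) :
  f @ totally --> (l : F^o) -> 0 < e ->
  exists A, forall B, (A `<=` B)%fset -> `|l - f B| < e.
Proof.
move=> /(@cvgrPdist_lt _ F^o _ _ totally_filter) fl e0.
by have [A _ Af] := fl e e0; exists A.
Qed.

Lemma partial_sum_seq (X : choiceType) (V : zmodType) (f : X -> V) (s : seq X) :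
  uniq s -> partial_sum f [fset x in s]%fset = \sum_(x <- s) f x.
Proof.
move=> us; rewrite /partial_sum -(big_seq_fsetE _ _ xpredT f) /=.
by apply: perm_big; apply: uniq_perm => // x; rewrite inE.
Qed.

Section Kernel.
Context {R : realType} {X : choiceType} (adj : rel X) (o : X) (q : nat).
Variables (alpha : R) (K : X -> X -> R).
Hypothesis tree : homogeneous_tree adj q.
Hypothesis q_ge2 : (2 <= q)%N.
Hypothesis alpha_gt1 : 1 < alpha.
Hypothesis repK : reproducing_kernel adj o q alpha K.

Local Notation child := (child adj o).
Local Notation below := (below adj o).
Local Notation depth := (depth adj o).
Local Notation kids := (kids adj o).
Local Notation nbr := (nbr adj).
Local Notation cone := (cone adj o).
Local Notation sector_radial := (@sector_radial R X adj o q).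
Local Notation weight := (weight adj o q alpha).
Local Notation r := (q%:R `^ (- alpha)).
Local Notation cone_mass := (cone_mass q r).

Lemma decay_gt0 : 0 < r. Proof. by rewrite powR_gt0 // qR_gt0. Qed.

Lemma decay_lt1 : q%:R * r < 1.
Proof.
have q0 : 0 < q%:R :> R := qR_gt0 q_ge2.
rewrite /powR (gt_eqF q0) -{1}(lnK q0) -expRD.
rewrite -[ltRHS]expR0 ltr_expR mulNr subr_lt0 ltr_pMl //.
by rewrite ln_gt0 // ltr1n.
Qed.

Lemma weightE x : weight x = r ^+ depth x.
Proof.
by rewrite /Defs.weight (graph_dist_depth _ tree) -mulNr powRrM powR_mulrn.
Qed.

Lemma weight_gt0 x : 0 < weight x.
Proof. by rewrite weightE exprn_gt0 // decay_gt0. Qed.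

Lemma harmonicR (f : X -> R) :
  Defs.harmonic adj q (fun x => (f x)%:C%C) <-> mean_valued adj q f.
Proof.
have sumE v : \sum_(u \in neighbours adj v) (f u)%:C%C =
    ((\sum_(u <- nbr v) f u)%:C)%C.
  rewrite (fsbig_finite _ _ (neighbours_finite tree v)).
  exact/esym/(rmorph_sum (real_complex R)).
have q0 : q.+1%:R != 0 :> R by rewrite pnatr_eq0.
split=> hf v.
  have := hf v; rewrite sumE -(rmorph_nat (real_complex R)) -fmorphV -rmorphM.
  by move=> /complexI ->; rewrite mulVKf.
rewrite sumE hf -(rmorph_nat (real_complex R)) -fmorphV -rmorphM /=.
by rewrite mulKf.
Qed.

Lemma kernel_mean_valued z : mean_valued adj q (K z).
Proof. by apply/harmonicR; have [[]] := repK z. Qed.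

(** These are the test functions for the reproducing property. *)
Lemma dipole_bergman p a b : child p a -> child p b ->
  bergman_space adj o q alpha
    (fun x => (sector_radial a x - sector_radial b x)%:C%C).
Proof.
move=> pa pb; split.
  apply/harmonicR => v; rewrite big_split /= sumrN.
  rewrite (sum_nbr_sector_radial tree q_ge2 v pa).
  rewrite (sum_nbr_sector_radial tree q_ge2 v pb).
  by ring.
apply: le_lt_trans (ltry (4 * cone_mass * (r ^+ depth a + r ^+ depth b))).
apply: esum_le_finite => s us _.
apply: (@le_trans _ _ (\sum_(x <- s) 4 * ((below a x)%:R * r ^+ depth x +
                                          (below b x)%:R * r ^+ depth x))).
  apply: ler_sum => x _; rewrite normcR /= weightE.
  rewrite -mulrDl mulrA ler_wpM2r ?exprn_ge0 ?(ltW decay_gt0) //.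
  rewrite real_normK ?num_real //.
  have := @sector_radial_ge0 R X adj o q a x.
  have := @sector_radial_ge0 R X adj o q b x.
  have := @sector_radial_le R X adj o q q_ge2 a x.
  have := @sector_radial_le R X adj o q q_ge2 b x.
  by case: (below a x); case: (below b x) => /=; nra.
rewrite -mulr_sumr -mulrA ler_wpM2l // big_split /= mulrDr lerD //.
  exact: (sum_weight_below tree decay_gt0 decay_lt1 us pa).
exact: (sum_weight_below tree decay_gt0 decay_lt1 us pb).
Qed.

(** The balls are cofinal among finite sets, so the reproducing property makes
    the sums over balls converge to the value of the dipole at z, while
    [pairing_ge] bounds them below. *)
Lemma kernel_siblings p a b z : child p a -> child p b ->
  `|K z a - K z b| * r ^+ depth a <= `|sector_radial a z - sector_radial b z|.
Proof.
move=> pa pb; rewrite leNgt; apply/negP => lt_h.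
(* Otherwise the sums over all large finite sets would be smaller in modulus
   than the lower bound for balls. *)
have [_ cvgK] := repK z.
have {}cvgK := cvg_totally (cvgK _ (dipole_bergman pa pb)).
have := cvgK (`|K z a - K z b| * r ^+ depth a -
              `|sector_radial a z - sector_radial b z|)%:C%C.
rewrite ltcR subr_gt0 => /(_ lt_h)[A Aball].
pose n := (\max_(x <- A) depth x + depth a)%N.+1.
pose B : {fset X} := [fset x in cone o n]%fset.
have memB x : (x \in B) = (x \in cone o n).
  by rewrite /B; move: (cone o n) => c; rewrite inE.
have AB : (A `<=` B)%fset.
  apply/fsubsetP => x xA; rewrite memB (mem_cone _ tree) below_root /=.
  rewrite addnS ltnS; apply: leq_trans (leq_addl _ _).
  by apply: leq_trans (leq_addr _ _); exact: leq_bigmax_seq.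
have := Aball B AB; rewrite /= partial_sum_seq ?(cone_uniq _ tree) //.
under eq_bigr => x _ do rewrite weightE -!rmorphM.
rewrite -rmorph_sum -rmorphB /= normcR ltcR.
have an : (depth a < n)%N by rewrite ltnS leq_addl.
have := pairing_ge tree q_ge2 decay_gt0 (kernel_mean_valued z) pa pb an.
set S := \sum_(_ <- _) _ => leS ltS.
have := ler_normB (sector_radial a z - sector_radial b z)
                  (sector_radial a z - sector_radial b z - S).
rewrite subKr => leS'.
by move: ltS; rewrite ltNge lerBlDl (le_trans leS).
Qed.

(** The factor r ^+ depth a lost in [kernel_siblings] is regained because the two
    sectors that carry the dipole have mass of that order. *)
Lemma sum_siblings (s : seq X) p a b : uniq s -> child p a -> child p b ->
  \sum_(z <- s) `|K z a - K z b| * weight z <= 4 * cone_mass.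
Proof.
move=> us pa pb; have ra0 : 0 < r ^+ depth a by rewrite exprn_gt0 // decay_gt0.
rewrite -(ler_pM2r ra0) mulr_suml.
apply: (@le_trans _ _ (\sum_(z <- s) 2 * ((below a z)%:R * r ^+ depth z +
                                          (below b z)%:R * r ^+ depth z))).
  apply: ler_sum => z _; rewrite mulrAC weightE -mulrDl mulrA.
  rewrite ler_wpM2r ?exprn_ge0 ?(ltW decay_gt0) //.
  apply: le_trans (kernel_siblings z pa pb) _.
  have := @sector_radial_ge0 R X adj o q a z.
  have := @sector_radial_ge0 R X adj o q b z.
  have := @sector_radial_le R X adj o q q_ge2 a z.
  have := @sector_radial_le R X adj o q q_ge2 b z.
  by rewrite ler_norml; lra.
rewrite -mulr_sumr big_split /=.
have := sum_weight_below tree decay_gt0 decay_lt1 us pa.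
have := sum_weight_below tree decay_gt0 decay_lt1 us pb.
by rewrite (depth_child pb) -(depth_child pa); lra.
Qed.

Lemma kernel_edge_root c z : child o c ->
  q.+1%:R * (K z c - K z o) = \sum_(b <- kids o) (K z c - K z b).
Proof.
move=> oc; rewrite big_split /= sumrN big_const_seq count_predT iter_addr_0.
by rewrite (kids_root _ tree) (size_nbr tree) kernel_mean_valued -mulr_natl; ring.
Qed.

(** The mean value property of K z at u, solved for the edge from u to c; the
    sibling differences measure how far K z is from being radial there. *)
Lemma kernel_edge p u c z : child p u -> child u c ->
  q%:R * (K z c - K z u) =
  (K z u - K z p) + \sum_(b <- kids u) (K z c - K z b).
Proof.
move=> pu uc; rewrite big_split /= sumrN big_const_seq count_predT iter_addr_0.
rewrite (size_kids tree pu) (sum_kids tree (kernel_mean_valued z) pu).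
by rewrite -mulr_natl -natr1; ring.
Qed.

Lemma sum_kids_diff (s : seq X) u c : uniq s -> child u c ->
  \sum_(z <- s) `|\sum_(b <- kids u) (K z c - K z b)| * weight z <=
  (size (kids u))%:R * (4 * cone_mass).
Proof.
move=> us uc.
apply: (@le_trans _ _
  (\sum_(z <- s) \sum_(b <- kids u) `|K z c - K z b| * weight z)).
  apply: ler_sum => z _; rewrite -mulr_suml ler_wpM2r ?(ltW (weight_gt0 z)) //.
  exact: ler_norm_sum.
rewrite exchange_big /= mulr_natl -iter_addr_0 -(count_predT (kids u)).
rewrite -big_const_seq.
rewrite big_seq [leRHS]big_seq; apply: ler_sum => b; rewrite (mem_kids _ tree).
exact: sum_siblings.
Qed.

(** The bound M = 8 [cone_mass] is preserved along edges: [kernel_edge] gives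
    (M + q M / 2) / q <= M because q >= 2. *)
Lemma sum_edge (s : seq X) u c : uniq s -> child u c ->
  \sum_(z <- s) `|K z c - K z u| * weight z <= 8 * cone_mass.
Proof.
move=> us; have mass0 := cone_mass_gt0 decay_lt1.
have q2 : 2 <= q%:R :> R by rewrite ler_nat.
elim/(@tree_ind _ _ o _ tree): u c => [|u c uc IH] d => [od|cd].
  have := sum_kids_diff us od.
  rewrite (kids_root _ tree) (size_nbr tree) -(kids_root _ tree).
  under eq_bigr => z _ do
    rewrite -(kernel_edge_root z od) normrM ger0_norm // -mulrA.
  by rewrite -mulr_sumr ler_pM2l //; lra.
have := sum_kids_diff us cd; rewrite (size_kids tree uc).
have := IH c uc.
set E := \sum_(_ <- _) _; set S := \sum_(_ <- _) _; set T := \sum_(_ <- _) _.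
move=> leE leS; suff : q%:R * T <= E + S by nra.
rewrite mulr_sumr -big_split /=; apply: ler_sum => z _.
rewrite -mulrDl mulrA ler_wpM2r ?(ltW (weight_gt0 z)) //.
rewrite -[q%:R in leLHS]ger0_norm // -normrM (kernel_edge z uc cd).
exact: ler_normD.
Qed.

Lemma kernel_siblings_outside p a b z : child p a -> child p b ->
  ~~ below a z -> ~~ below b z -> K z a = K z b.
Proof.
move=> pa pb az bz; have := kernel_siblings z pa pb.
rewrite (sector_radial_outside q az) (sector_radial_outside q bz).
rewrite subr0 normr0 pmulr_lle0.
  by rewrite normr_le0 subr_eq0 => /eqP.
by rewrite exprn_gt0 // decay_gt0.
Qed.

(** Seen from z, K z is radial on the sector of v, and its edge differences are
    divided by q at every step down. Keeping the last edge difference in the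
    statement makes it inductive: as 2 <= q, it pays both for the new step and
    for the new last edge. *)
Lemma kernel_outside_sector p v x z : child p v -> below v x -> ~~ below v z ->
  `|K z x - K z v| + `|K z x - K z (parent adj o x)| <= `|K z v - K z p|.
Proof.
move=> pv + vz; elim/(@tree_ind _ _ o _ tree): x => [|u c uc IH vc].
  rewrite /below (rpath_root _ tree) inE => /eqP vo.
  by move: pv; rewrite vo (not_child_root _ tree).
rewrite (parent_child tree uc).
move: (vc); rewrite (below_child _ uc) => /orP[/eqP vec|vu].
  by move: uc; rewrite -vec subrr normr0 add0r => /(parent_child tree) <-;
    rewrite (parent_child tree pv).
have [w wu] := below_has_parent tree pv vu.
have := IH vu; rewrite (parent_child tree wu) => {IH}; apply: le_trans.
have outside b : b \in kids u -> ~~ below b z.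
  rewrite (mem_kids _ tree) => ub; apply: contraNN vz => bz.
  by apply: (below_trans tree _ bz); rewrite (below_child _ ub) vu orbT.
have := kernel_edge z wu uc; rewrite big_seq big1 => [|b bu]; last first.
  apply/eqP; rewrite subr_eq0; apply/eqP.
  apply: (kernel_siblings_outside uc) => //; last exact: outside.
  - by rewrite -(mem_kids _ tree).
  - by apply: outside; rewrite (mem_kids _ tree).
rewrite addr0 => edge.
have : q%:R * `|K z c - K z u| = `|K z u - K z w|.
  by rewrite -edge normrM ger0_norm.
have := ler_distD (K z u) (K z c) (K z v).
have q2 : 2 <= q%:R :> R by rewrite ler_nat.
by have := normr_ge0 (K z c - K z u); nra.
Qed.

(** Both x and y are compared with v, at the cost of one edge difference each. *)
Lemma sum_outside_sector (s : seq X) v x y : v <> o -> uniq s ->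
  (forall z, z \in s -> ~~ below v z) -> below v x -> below v y ->
  \sum_(z <- s) `|K z x - K z y| * weight z <= 16 * cone_mass.
Proof.
move=> vo us sv vx vy; have [//|[p pv]] := childP o tree v.
apply: (@le_trans _ _ (2 * \sum_(z <- s) `|K z v - K z p| * weight z)); last first.
  by have := sum_edge us pv; lra.
rewrite mulr_sumr big_seq [leRHS]big_seq; apply: ler_sum => z zs.
rewrite mulrA ler_wpM2r ?(ltW (weight_gt0 z)) //.
have := kernel_outside_sector pv vx (sv z zs).
have := kernel_outside_sector pv vy (sv z zs).
have := ler_distD (K z v) (K z x) (K z y); rewrite (distrC (K z v) (K z y)).
have := normr_ge0 (K z x - K z (parent adj o x)).
have := normr_ge0 (K z y - K z (parent adj o y)).
by lra.
Qed.

End Kernel.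

(** * The uniform bound *)

Theorem proposition13 (R : realType) (q : nat) (X : choiceType) (adj : rel X)
    (o : X) (alpha : R) (K : X -> X -> R) :
  (2 <= q)%N -> homogeneous_tree adj q -> 1 < alpha ->
  reproducing_kernel adj o q alpha K ->
  (ereal_sup
     [set ereal_sup
        [set \esum_(z in ~` sector adj o v)
               (`|K z xy.1 - K z xy.2| * weight adj o q alpha z)%:E
        | xy in sector adj o v `*` sector adj o v]
     | v in [set~ o]]
   < +oo)%E.
Proof.
move=> q_ge2 tree alpha_gt1 repK.
apply: le_lt_trans (ltry (16 * cone_mass q (q%:R `^ (- alpha)))).
apply: ge_ereal_sup => _ [v /= vo <-].
apply: ge_ereal_sup => _ [[x y] /= [vx vy] <-].
move/(sector_below o tree) in vx; move/(sector_below o tree) in vy.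
apply: esum_le_finite => s us sv.
apply: (sum_outside_sector tree q_ge2 alpha_gt1 repK vo) => // z /sv zv.
by apply/negP => /(sector_below o tree).
Qed.
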